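(* Let $t \ge 2$ be an integer and let $n \ge m$ be positive integers. Then $$\mathrm{ex}\left(n, m, \{C_4, \theta_{3,t}\}\right) \le \sqrt[3]{t-1}\,(mn)^{2/3} + (1+o(1))\,t\,n^{3/4}m^{1/2} + m\sqrt[3]{n} + n,$$ where $o(1)$ tends to $0$ as $n \to \infty$.
   Context: For positive integers $n, m$ and a family $\mathcal{F}$ of graphs, the bipartite Turán number $\mathrm{ex}(n,m,\mathcal{F})$ is the maximum number of edges in a bipartite graph with parts of sizes $m$ and $n$ that contains no graph of $\mathcal{F}$ as a subgraph. $C_4$ is the cycle of length $4$, and $\theta_{3,t}$ is the graph consisting of two vertices joined by $t$ internally vertex-disjoint paths, each of length $3$. *)

(* Defs.v *)
From mathcomp Require Import all_boot all_order all_algebra.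
From mathcomp Require Import all_classical all_reals all_analysis.

Set Implicit Arguments.
Unset Strict Implicit.
Unset Printing Implicit Defensive.

Record sgraph := SGraph {
  vertex :> finType;
  adj : rel vertex;
  adj_sym : symmetric adj;
  adj_irr : irreflexive adj
}.

(* Subgraph containment, up to isomorphism and not necessarily induced. *)
Definition contains (G H : sgraph) : Prop :=
  exists f : H -> G,
    injective f /\ (forall x y : H, adj x y -> adj (f x) (f y)).

Definition family_free (F : sgraph -> Prop) (G : sgraph) : Prop :=
  forall H : sgraph, F H -> ~ contains G H.

Definition C4_adj : rel 'I_4 := fun i j => (j == ordS i) || (i == ordS j).

Lemma C4_adj_sym : symmetric C4_adj.
Proof. by move=> i j; rewrite /C4_adj orbC. Qed.

Lemma C4_adj_irr : irreflexive C4_adj.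
Proof. by case; do 4!case=> //. Qed.

Definition C4 : sgraph := SGraph C4_adj_sym C4_adj_irr.

(* The two end vertices are [inl false] and [inl true]; the i-th path is
   inl false -- inr (false, i) -- inr (true, i) -- inl true. *)
Definition theta3_adj (t : nat) : rel (bool + bool * 'I_t) :=
  fun x y => match x, y with
  | inl _, inl _ => false
  | inl b, inr (c, _) => b == c
  | inr (c, _), inl b => b == c
  | inr (b, i), inr (c, j) => (b != c) && (i == j)
  end.

Lemma theta3_adj_sym (t : nat) : symmetric (@theta3_adj t).
Proof.
by move=> [b|[b i]] [c|[c j]] //=; rewrite (eq_sym b) (eq_sym i).
Qed.

Lemma theta3_adj_irr (t : nat) : irreflexive (@theta3_adj t).
Proof. by move=> [b|[b i]] //=; rewrite eqxx. Qed.

Definition theta3 (t : nat) : sgraph :=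
  SGraph (@theta3_adj_sym t) (@theta3_adj_irr t).

Definition bip_adj (m n : nat) (E : {set 'I_m * 'I_n}) : rel ('I_m + 'I_n) :=
  fun x y => match x, y with
  | inl i, inr j => (i, j) \in E
  | inr j, inl i => (i, j) \in E
  | _, _ => false
  end.

Lemma bip_adj_sym (m n : nat) (E : {set 'I_m * 'I_n}) : symmetric (bip_adj E).
Proof. by move=> [i|i] [j|j]. Qed.

Lemma bip_adj_irr (m n : nat) (E : {set 'I_m * 'I_n}) :
  irreflexive (bip_adj E).
Proof. by case. Qed.

(* The bipartite graph with parts 'I_m and 'I_n; an edge is recorded once, as
   the pair of its endpoints, so the graph has #|E| edges. *)
Definition bip_graph (m n : nat) (E : {set 'I_m * 'I_n}) : sgraph :=
  SGraph (bip_adj_sym E) (bip_adj_irr E).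

Definition bip_ex (n m : nat) (F : sgraph -> Prop) : nat :=
  \max_(E : {set 'I_m * 'I_n} | `[< family_free F (bip_graph E) >]) #|E|.

(* Main.v *)
(** In a graph without C4, the paths of length 3 joining two vertices of opposite
    parts are internally disjoint, so excluding theta_{3,t} leaves at most t - 1
    of them.  Counting these paths by their middle edge ab gives
      S = sum_{ab in E} (d(a) - 1)(d(b) - 1) <= (t - 1) m n.
    Conversely put Z = sum_{ab in E} (1 - 1/d(a))(1 - 1/d(b)); since the reciprocal
    degrees sum over the edges to at most m and n, Z >= e - m - n, and AM-GM gives
    Z^3 <= m n S.  Hence e <= (t - 1)^(1/3) (m n)^(2/3) + m + n, which is stronger
    than required: the error term o can be taken to be 0. *)
Require Import Defs.
From mathcomp Require Import all_boot all_order all_algebra.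
From mathcomp Require Import all_classical all_reals all_analysis.
From mathcomp Require Import ring lra.
Import Order.TTheory GRing.Theory Num.Theory.
Import numFieldNormedType.Exports.
Local Open Scope classical_set_scope.
Local Open Scope ring_scope.

(** * Excluded subgraphs and the double count of paths of length 3 *)

Lemma C4_free_bip (m n : nat) (E : {set 'I_m * 'I_n}) (a a' : 'I_m)
    (b b' : 'I_n) :
  ~ contains (bip_graph E) C4 ->
  (a, b) \in E -> (a, b') \in E -> (a', b) \in E -> (a', b') \in E ->
  a != a' -> b = b'.
Proof.
move=> noC4 ab ab' a'b a'b' /eqP aa'; apply/eqP/negPn/negP => /eqP bb'.
apply: noC4.
(* The forbidden cycle is a, b, a', b' in this order, so parity selects the part. *)
exists (fun i : 'I_4 => if odd i then inr (if i == 1 :> nat then b else b')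
                        else inl (if i == 0 :> nat then a else a')).
split.
- move=> [[|[|[|[|i]]]] //= hi] [[|[|[|[|j]]]] //= hj] h;
    by [exact: val_inj | case: h => h; case: aa' | case: h => h; case: bb'].
- by move=> [[|[|[|[|i]]]] //= hi] [[|[|[|[|j]]]] //= hj].
Qed.

Section Degrees.
Context {m n : nat}.
Implicit Type E : {set 'I_m * 'I_n}.

Definition left_nbh E (b : 'I_n) : {set 'I_m} := [set a | (a, b) \in E]%SET.
Definition right_nbh E (a : 'I_m) : {set 'I_n} := [set b | (a, b) \in E]%SET.

(* The path q.1 - p.2 - p.1 - q.2, with middle edge p; it is not required here
   that p is an edge. *)
Definition path3 E (p q : 'I_m * 'I_n) : bool :=
  [&& (q.1, p.2) \in E, (p.1, q.2) \in E, q.1 != p.1 & q.2 != p.2].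

Lemma card_path3_center E (p : 'I_m * 'I_n) : p \in E ->
  #|[set q | path3 E p q]%SET| =
    ((#|left_nbh E p.2|).-1 * (#|right_nbh E p.1|).-1)%N.
Proof.
case: p => a b abE; set L := left_nbh E b; set Rt := right_nbh E a.
have -> : [set q | path3 E (a, b) q]%SET = finset.setX (L :\ a)%SET (Rt :\ b)%SET.
  by apply/setP => -[u v]; rewrite !inE /path3 /=; do !case: (_ \in _) => //=;
    rewrite ?andbT ?andbF.
by rewrite cardsX [in RHS](cardsD1 a) [#|Rt| in RHS](cardsD1 b) !inE abE.
Qed.

(** Let q = (u, v). Two middle edges ab and ab' with b != b' would close the 4-cycle u, b, a, b';
    two middle edges ab and a'b with a != a' would close a, b, a', v. So the middle edges form a
    matching that avoids u and v, and t of them would yield [theta3 t]. *)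
Lemma card_path3_ends E (t : nat) (q : 'I_m * 'I_n) :
  ~ contains (bip_graph E) C4 -> ~ contains (bip_graph E) (theta3 t) ->
  (#|[set p in E | path3 E p q]%SET| <= t.-1)%N.
Proof.
case: q => u v noC4 noTheta; set T := finset _.
have injA p p' : p \in T -> p' \in T -> p.1 = p'.1 -> p = p'.
  case: p p' => [a b] [a' b']; rewrite !inE /path3 /=.
  move=> /and5P[abE ubE avE ua vb] /and5P[ab'E ub'E _ _ _] aa'.
  rewrite -aa' in ab'E *; congr pair.
  exact: (C4_free_bip _ _ E u a).
have injB p p' : p \in T -> p' \in T -> p.2 = p'.2 -> p = p'.
  case: p p' => [a b] [a' b']; rewrite !inE /path3 /=.
  move=> /and5P[abE ubE avE ua vb] /and5P[ab'E _ a'vE _ _] bb'.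
  rewrite -bb' in ab'E *; congr pair; apply/eqP/negPn/negP => aa'.
  have := C4_free_bip _ _ E a a' b v noC4 abE avE ab'E a'vE aa'.
  by move=> /eqP; rewrite eq_sym (negPf vb).
rewrite leqNgt; apply/negP => ltT; apply: noTheta.
have leT : (t <= #|T|)%N by apply: leq_trans ltT; exact: leqSpred.
pose g (i : 'I_t) := enum_val (widen_ord leT i).
have gT i : g i \in T by exact: enum_valP.
have ginj : injective g by move=> i j /enum_val_inj /(congr1 val) /= /val_inj.
have gP i : [/\ g i \in E, (u, (g i).2) \in E, ((g i).1, v) \in E,
    u != (g i).1 & v != (g i).2].
  by have := gT i; rewrite inE => /and5P.
(* The neighbours of u lie in the right part, so the i-th path runs u, [(g i).2], [(g i).1], v. *)
exists (fun x : theta3 t => match x with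
  | inl false => inl u
  | inl true => inr v
  | inr (false, i) => inr (g i).2
  | inr (true, i) => inl (g i).1
  end); split.
- move=> [[]|[[] i]] [[]|[[] j]] //= [] h; rewrite ?h //;
    try by [have [_ _ _] := gP j; rewrite h eqxx
           |have [_ _ _] := gP i; rewrite h eqxx
           |have [_ _ _ _] := gP j; rewrite h eqxx
           |have [_ _ _ _] := gP i; rewrite h eqxx].
  + by rewrite (ginj _ _ (injA _ _ (gT i) (gT j) h)).
  + by rewrite (ginj _ _ (injB _ _ (gT i) (gT j) h)).
- move=> [[]|[[] i]] [[]|[[] j]] //=.
  + by move=> _; have [] := gP j.
  + by move=> _; have [] := gP j.
  + by move=> _; have [] := gP i.
  + by move=> /eqP <-; rewrite -surjective_pairing; have [] := gP i.
  + by move=> _; have [] := gP i.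
  + by move=> /eqP <-; rewrite -surjective_pairing; have [] := gP i.
Qed.

(** Exchanging the sums counts the paths by their pair of ends instead of their middle edge; each of
    the m n pairs accounts for at most [t.-1] paths. *)
Lemma sum_path3 E (t : nat) :
  ~ contains (bip_graph E) C4 -> ~ contains (bip_graph E) (theta3 t) ->
  (\sum_(p in E) (#|left_nbh E p.2|).-1 * (#|right_nbh E p.1|).-1
     <= t.-1 * (m * n))%N.
Proof.
move=> noC4 noTheta.
under eq_bigr => p pE do rewrite -(card_path3_center _ _ pE) -sum1dep_card.
rewrite (exchange_big_dep predT) //=.
have -> : (m * n)%N = #|{: 'I_m * 'I_n}| by rewrite card_prod !card_ord.
rewrite mulnC -sum_nat_const; apply: leq_sum => q _.
rewrite sum1dep_card; exact: card_path3_ends.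
Qed.

(** * Sums of reciprocal degrees over the edges *)

Lemma sum_inv_right_nbh (R : realFieldType) E :
  \sum_(p in E) (#|right_nbh E p.1|%:R : R)^-1 <= m%:R.
Proof.
have -> : \sum_(p in E) (#|right_nbh E p.1|%:R : R)^-1 =
    \sum_a \sum_(b | (a, b) \in E) (#|right_nbh E a|%:R : R)^-1.
  by rewrite pair_big_dep /=; apply: eq_bigl => -[].
rewrite -[in leRHS](card_ord m) -sum1_card natr_sum; apply: ler_sum => a _.
rewrite sumr_const.
have -> : #|[pred b | (a, b) \in E]| = #|right_nbh E a|.
  by apply: eq_card => b; rewrite !inE.
(* A vertex of degree d > 0 contributes d * (1/d) = 1, an isolated one contributes 0. *)
rewrite -[leLHS]mulr_natr; case: (posnP #|right_nbh E a|) => [->|d_gt0].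
  by rewrite mulr0 ler01.
by rewrite mulVf // pnatr_eq0 -lt0n.
Qed.

Lemma sum_inv_left_nbh (R : realFieldType) E :
  \sum_(p in E) (#|left_nbh E p.2|%:R : R)^-1 <= n%:R.
Proof.
have -> : \sum_(p in E) (#|left_nbh E p.2|%:R : R)^-1 =
    \sum_b \sum_(a | (a, b) \in E) (#|left_nbh E b|%:R : R)^-1.
  rewrite (exchange_big_dep predT) //= pair_big_dep /=.
  by apply: eq_bigl => -[].
rewrite -[in leRHS](card_ord n) -sum1_card natr_sum; apply: ler_sum => b _.
rewrite sumr_const.
have -> : #|[pred a | (a, b) \in E]| = #|left_nbh E b|.
  by apply: eq_card => a; rewrite !inE.
rewrite -[leLHS]mulr_natr; case: (posnP #|left_nbh E b|) => [->|d_gt0].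
  by rewrite mulr0 ler01.
by rewrite mulVf // pnatr_eq0 -lt0n.
Qed.

End Degrees.

(** * AM-GM and the lower bound on the number of paths *)

Lemma mul3_le1 (R : realFieldType) (u v : R) :
  0 <= u -> 0 <= v -> u * v * (3 - u - v) <= 1.
Proof.
move=> u0 v0; have uv0 : 0 <= u * v by exact: mulr_ge0.
(* This is AM-GM for u, v and 3 - u - v, whose sum is 3. If the third is negative, the product is at
   most 0. *)
case: (lerP (u + v) 3) => h; last first.
  by apply: (@le_trans _ _ 0) => //; apply: mulr_ge0_le0 => //; lra.
have h1 : u * v * (3 - u - v) <= ((u + v) / 2) ^+ 2 * (3 - (u + v)).
  rewrite -addrA -opprD; apply: ler_wpM2r; first lra.
  by have := sqr_ge0 (u - v); nra.
(* With s = u + v, 1 - (s/2)^2 (3 - s) = (s - 2)^2 (s + 1) / 4. *)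
apply: le_trans h1 _.
have : 0 <= (u + v - 2) ^+ 2 * (u + v + 1).
  by apply: mulr_ge0; [exact: sqr_ge0|lra].
nra.
Qed.

(** With P = 1/d(a) and Q = 1/d(b), each summand (d(a) - 1)(d(b) - 1) equals z / (P Q). [mul3_le1]
    bounds 1 / (P Q) below by an expression affine in P and Q, so that summing with weights z leaves
    only the sums of z, z P and z Q. *)
Lemma path3_lower_bound (R : realFieldType) (m n : nat)
    (E : {set 'I_m * 'I_n}) : (0 < m)%N -> (0 < n)%N ->
  m%:R + n%:R <= #|E|%:R :> R ->
  (#|E|%:R - m%:R - n%:R : R) ^+ 3 <= (m%:R * n%:R) *
    (\sum_(p in E) (#|left_nbh E p.2|).-1 * (#|right_nbh E p.1|).-1)%N%:R.
Proof.
move=> m0 n0 le_e.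
pose P (p : 'I_m * 'I_n) : R := (#|right_nbh E p.1|%:R)^-1.
pose Q (p : 'I_m * 'I_n) : R := (#|left_nbh E p.2|%:R)^-1.
pose z p := (1 - P p) * (1 - Q p).
set Z := \sum_(p in E) z p.
have degA p : p \in E -> (0 < #|right_nbh E p.1|)%N.
  by case: p => a b pE; apply/card_gt0P; exists b; rewrite inE.
have degB p : p \in E -> (0 < #|left_nbh E p.2|)%N.
  by case: p => a b pE; apply/card_gt0P; exists a; rewrite inE.
have P0 p : p \in E -> 0 < P p by move=> /degA h; rewrite invr_gt0 ltr0n.
have Q0 p : p \in E -> 0 < Q p by move=> /degB h; rewrite invr_gt0 ltr0n.
have P1 p : p \in E -> P p <= 1.
  by move=> /degA h; rewrite invf_le1 ?ltr0n // ler1n.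
have Q1 p : p \in E -> Q p <= 1.
  by move=> /degB h; rewrite invf_le1 ?ltr0n // ler1n.
have z0 p : p \in E -> 0 <= z p.
  by move=> pE; apply: mulr_ge0; rewrite subr_ge0; [exact: P1|exact: Q1].
have z1 p : p \in E -> z p <= 1.
  by move=> pE; rewrite /z; have := P0 _ pE; have := Q0 _ pE;
    have := P1 _ pE; have := Q1 _ pE; nra.
(* Expanding z gives 1 - P - Q + P Q, and the last term is dropped. *)
have Zlow : #|E|%:R - m%:R - n%:R <= Z.
  apply: (@le_trans _ _ (\sum_(p in E) (1 - P p - Q p))).
    rewrite !sumrB sumr_const.
    by have := sum_inv_right_nbh R E; have := sum_inv_left_nbh R E;
      rewrite /P /Q; lra.
  apply: ler_sum => p pE; rewrite /z.
  by have := P0 _ pE; have := Q0 _ pE; nra.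
have sumzP : \sum_(p in E) z p * P p <= m%:R.
  apply: le_trans (sum_inv_right_nbh R E); apply: ler_sum => p pE.
  by rewrite ler_piMl ?z1 // ltW ?P0.
have sumzQ : \sum_(p in E) z p * Q p <= n%:R.
  apply: le_trans (sum_inv_left_nbh R E); apply: ler_sum => p pE.
  by rewrite ler_piMl ?z1 // ltW ?Q0.
have M0 : 0 < m%:R :> R by rewrite ltr0n.
have N0 : 0 < n%:R :> R by rewrite ltr0n.
have Z0 : 0 <= Z by apply: sumr_ge0.
apply: (@le_trans _ _ (Z ^+ 3)).
  by rewrite lerXn2r ?nnegrE //; lra.
rewrite natr_sum.
(* AM-GM with the normalised weights [u = Z P / m] and [v = Z Q / n] *)
have main p : p \in E ->
  z p * (Z ^+ 2 / (m%:R * n%:R) * (3 - P p * (Z / m%:R) - Q p * (Z / n%:R)))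
   <= ((#|left_nbh E p.2|).-1 * (#|right_nbh E p.1|).-1)%N%:R.
  move=> pE; have p0 := P0 _ pE; have q0 := Q0 _ pE.
  have -> : ((#|left_nbh E p.2|).-1 * (#|right_nbh E p.1|).-1)%N%:R =
      z p * ((P p)^-1 * (Q p)^-1).
    rewrite natrM -!subn1 !natrB ?degA ?degB //.
    rewrite -[#|left_nbh _ _|%:R]invrK -[#|right_nbh _ _|%:R]invrK.
    rewrite -/(P p) -/(Q p) /z; field; rewrite !gt_eqF //.
  apply: ler_wpM2l; first exact: z0.
  rewrite -invfM -[leRHS]mul1r ler_pdivlMr ?mulr_gt0 //.
  have := mul3_le1 _ (P p * (Z / m%:R)) (Q p * (Z / n%:R)).
  have -> : P p * (Z / m%:R) * (Q p * (Z / n%:R)) =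
      Z ^+ 2 / (m%:R * n%:R) * (P p * Q p).
    by field; rewrite !gt_eqF.
  rewrite mulrAC; apply; apply: mulr_ge0; rewrite ?(ltW p0) ?(ltW q0) //;
    by rewrite divr_ge0 ?ler0n.
have le_sum : Z ^+ 2 / (m%:R * n%:R) * (3 * Z
    - (\sum_(p in E) z p * P p) * (Z / m%:R)
    - (\sum_(p in E) z p * Q p) * (Z / n%:R)) <=
  \sum_(p in E) ((#|left_nbh E p.2|).-1 * (#|right_nbh E p.1|).-1)%N%:R.
  have -> : 3 * Z = \sum_(p in E) 3 * z p by rewrite mulr_sumr.
  clearbody Z; rewrite !mulr_suml -!sumrB mulr_sumr.
  apply: le_trans (ler_sum _ main); apply: ler_sum => p _.
  by rewrite [leLHS](_ : _ = z p * (Z ^+ 2 / (m%:R * n%:R) *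
    (3 - P p * (Z / m%:R) - Q p * (Z / n%:R)))) //; ring.
rewrite -ler_pdivrMl ?mulr_gt0 //; apply: le_trans le_sum.
have -> : (m%:R * n%:R)^-1 * Z ^+ 3 = Z ^+ 2 / (m%:R * n%:R) * Z by ring.
apply: ler_wpM2l.
  by rewrite divr_ge0 ?exprn_ge0 // mulr_ge0.
(* Each subtracted term is at most Z, so the bracket in [le_sum] is at least 3 Z - Z - Z = Z. *)
have hP : (\sum_(p in E) z p * P p) * (Z / m%:R) <= Z.
  by rewrite mulrA ler_pdivrMr // [leRHS]mulrC ler_wpM2r.
have hQ : (\sum_(p in E) z p * Q p) * (Z / n%:R) <= Z.
  by rewrite mulrA ler_pdivrMr // [leRHS]mulrC ler_wpM2r.
lra.
Qed.

Theorem theorem5p1 (R : realType) (t : nat) (ht : (2 <= t)%N) :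
  exists o : nat -> R,
    (o n @[n --> \oo] --> (0 : R)) /\
    (forall n m : nat, (0 < m)%N -> (m <= n)%N ->
      (bip_ex n m (fun H => H = C4 \/ H = theta3 t))%:R
        <= (t%:R - 1 : R) `^ (1 / 3) * (m%:R * n%:R) `^ (2 / 3)
           + (1 + o n) * t%:R * n%:R `^ (3 / 4) * m%:R `^ (1 / 2)
           + m%:R * n%:R `^ (1 / 3) + n%:R).
Proof.
exists (fun=> 0); split; first exact: cvg_cst.
move=> n m m0 mn; have n0 : (0 < n)%N := leq_trans m0 mn.
rewrite /bip_ex.
(* An upper bound on every member bounds the maximum once it is nonnegative, since an empty maximum
   is 0. *)
apply: (big_ind (fun k : nat => (k%:R : R) <= _)).
- by rewrite !addr_ge0 ?mulr_ge0 ?powR_ge0 ?ler0n // addr0.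
- by move=> x y hx hy; rewrite /maxn; case: ifP.
move=> E /asboolP freeE.
have noC4 : ~ contains (bip_graph E) C4 by apply: freeE; left.
have noTheta : ~ contains (bip_graph E) (theta3 t) by apply: freeE; right.
have M0 : 0 < m%:R :> R by rewrite ltr0n.
have N0 : 0 < n%:R :> R by rewrite ltr0n.
have t1 : 0 <= t%:R - 1 :> R by rewrite subr_ge0 ler1n ltnW.
set c := _ `^ (1 / 3) * _ `^ (2 / 3).
have c0 : 0 <= c by rewrite mulr_ge0 ?powR_ge0.
have c3 : c ^+ 3 = (t%:R - 1) * (m%:R * n%:R) ^+ 2.
  rewrite exprMn -!powR_mulrn ?powR_ge0 // -!powRrM.
  rewrite (_ : 1 / 3 * 3%:R = 1 :> R); last by field.
  rewrite (_ : 2 / 3 * 3%:R = 2%:R :> R); last by field.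
  by rewrite powRr1 // powR_mulrn // mulr_ge0 // ltW.
(* If e < m + n this follows from c >= 0; otherwise e - m - n is nonnegative and can be compared
   with c through cubes. *)
have main : #|E|%:R <= c + m%:R + n%:R.
  case: (lerP (m%:R + n%:R : R) #|E|%:R) => he; last by lra.
  suff : #|E|%:R - m%:R - n%:R <= c by lra.
  rewrite -(@ler_pXn2r _ 3) ?nnegrE //; last by lra.
  apply: le_trans (path3_lower_bound _ _ _ _ m0 n0 he) _.
  rewrite c3 expr2 [leRHS]mulrCA.
  rewrite ler_pM2l ?mulr_gt0 //.
  have := sum_path3 _ _ noC4 noTheta; rewrite -(ler_nat R) !natrM.
  by rewrite -subn1 natrB // ltnW.
apply: le_trans main _.
(* Since n >= 1, the summand m is absorbed by m n^(1/3); the middle term of the target is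
   nonnegative and is dropped. *)
have mroot : m%:R <= m%:R * n%:R `^ (1 / 3) :> R.
  apply: ler_peMr; first exact: ltW.
  by rewrite -[leLHS](powRr0 n%:R) ler_powR ?ler1n.
have : 0 <= (1 + 0) * t%:R * n%:R `^ (3 / 4) * m%:R `^ (1 / 2) :> R.
  by rewrite addr0 !mulr_ge0 ?powR_ge0 ?ler0n.
lra.
Qed.
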